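(* For any Diophantine logic formula $A$ one can compute a list $l$ of elementary Diophantine constraints such that for every valuation $\nu:\mathbb N\to\mathbb N$ of the parameters, $$[\![A]\!]\nu\iff\exists\varphi:\mathbb N\to\mathbb N,\ [\![l]\!]^\varphi_\nu.$$
   Context: Diophantine logic formulas are $A,B::= x_i\doteq n\mid x_i\doteq x_j\mid x_i\doteq x_j\dot+x_k\mid x_i\doteq x_j\dot\times x_k\mid A\dot\wedge B\mid A\dot\vee B\mid\dot\exists A$, where $n\in\mathbb N$ and the variables are De Bruijn indices $i,j,k\in\mathbb N$. For $\nu:\mathbb N\to\mathbb N$, the semantics is as follows. - $[\![x_i\doteq n]\!]\nu\iff\nu(i)=n$ and $[\![x_i\doteq x_j]\!]\nu\iff\nu(i)=\nu(j)$. - $[\![x_i\doteq x_j\dot+x_k]\!]\nu\iff\nu(i)=\nu(j)+\nu(k)$ and $[\![x_i\doteq x_j\dot\times x_k]\!]\nu\iff\nu(i)=\nu(j)\nu(k)$. - $\dot\wedge$ and $\dot\vee$ are interpreted as $\wedge$ and $\vee$. - $[\![\dot\exists A]\!]\nu\iff\exists n,\ [\![A]\!](n\cdot\nu)$, where $(n\cdot\nu)(0)=n$ and $(n\cdot\nu)(i+1)=\nu(i)$. Elementary Diophantine constraints are $u\doteq n$, $u\doteq v$, $u\doteq x_i$, $u\doteq v\dot+w$ and $u\doteq v\dot\times w$, with existential variables $u,v,w\in\mathbb N$, parameters $x_i$ ($i\in\mathbb N$) and $n\in\mathbb N$. Under $\varphi:\mathbb N\to\mathbb N$ (variables) and $\nu:\mathbb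 N\to\mathbb N$ (parameters), their semantics is as follows. - $\varphi(u)=n$, $\varphi(u)=\varphi(v)$ and $\varphi(u)=\nu(i)$ respectively for the first three. - $\varphi(u)=\varphi(v)+\varphi(w)$ and $\varphi(u)=\varphi(v)\varphi(w)$ respectively for the last two. $[\![l]\!]^\varphi_\nu$ means every constraint in $l$ holds. *)

(* Defs.v *)
From Stdlib Require Export List.

Inductive dio_formula : Type :=
| df_cst : nat -> nat -> dio_formula          (* x_i = n *)
| df_eq  : nat -> nat -> dio_formula          (* x_i = x_j *)
| df_add : nat -> nat -> nat -> dio_formula   (* x_i = x_j + x_k *)
| df_mul : nat -> nat -> nat -> dio_formula   (* x_i = x_j * x_k *)
| df_conj : dio_formula -> dio_formula -> dio_formula
| df_disj : dio_formula -> dio_formula -> dio_formula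
| df_exst : dio_formula -> dio_formula.       (* binds index 0 *)

Definition scons (n : nat) (nu : nat -> nat) (i : nat) : nat :=
  match i with
  | 0 => n
  | S j => nu j
  end.

Fixpoint df_sem (A : dio_formula) (nu : nat -> nat) : Prop :=
  match A with
  | df_cst i n => nu i = n
  | df_eq i j => nu i = nu j
  | df_add i j k => nu i = nu j + nu k
  | df_mul i j k => nu i = nu j * nu k
  | df_conj B C => df_sem B nu /\ df_sem C nu
  | df_disj B C => df_sem B nu \/ df_sem C nu
  | df_exst B => exists n : nat, df_sem B (scons n nu)
  end.

(* Existential variables [u], [v], [w] and parameters [x_i] are both named by
   natural numbers, but live in separate name spaces: the former are valued by
   [phi] and the latter, which occur only in [dc_par], by [nu]. *)
Inductive dio_constraint : Type :=
| dc_cst : nat -> nat -> dio_constraint         (* u = n *)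
| dc_eq  : nat -> nat -> dio_constraint         (* u = v *)
| dc_par : nat -> nat -> dio_constraint         (* u = x_i *)
| dc_add : nat -> nat -> nat -> dio_constraint  (* u = v + w *)
| dc_mul : nat -> nat -> nat -> dio_constraint. (* u = v * w *)

Definition dc_sem (phi nu : nat -> nat) (c : dio_constraint) : Prop :=
  match c with
  | dc_cst u n => phi u = n
  | dc_eq u v => phi u = phi v
  | dc_par u i => phi u = nu i
  | dc_add u v w => phi u = phi v + phi w
  | dc_mul u v w => phi u = phi v * phi w
  end.

Definition dc_list_sem (phi nu : nat -> nat) (l : list dio_constraint) : Prop :=
  Forall (dc_sem phi nu) l.

(* Main.v *)
(** Every formula is equivalent to a single polynomial equation [p = q] over
    the naturals, closed by existential quantifiers.  Conjunction and disjunction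
    combine the two equations through the integer identities
    [(p1 - q1)^2 + (p2 - q2)^2 = 0] and [(p1 - q1) (p2 - q2) = 0], rearranged so
    that no subtraction occurs.  Naming the value of every subterm of [p] and [q]
    by a fresh existential variable then breaks the equation into elementary
    constraints; these names are never over-constrained, because the value of a
    subterm always exists. *)

Require Import Defs.
From Stdlib Require Import List.
From Stdlib Require Import Arith ZArith Lia.

(** * Polynomials in variables and parameters, and substitution *)

Inductive poly : Type :=
| p_cst : nat -> poly
| p_var : nat -> poly
| p_par : nat -> poly
| p_add : poly -> poly -> poly
| p_mul : poly -> poly -> poly.

Fixpoint eval (phi nu : nat -> nat) (p : poly) : nat :=
  match p with
  | p_cst n => n
  | p_var v => phi v
  | p_par i => nu i
  | p_add p q => eval phi nu p + eval phi nu q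
  | p_mul p q => eval phi nu p * eval phi nu q
  end.

Fixpoint subst (f g : nat -> poly) (p : poly) : poly :=
  match p with
  | p_cst n => p_cst n
  | p_var v => f v
  | p_par i => g i
  | p_add p q => p_add (subst f g p) (subst f g q)
  | p_mul p q => p_mul (subst f g p) (subst f g q)
  end.

Lemma eval_subst (f g : nat -> poly) (phi nu phi' nu' : nat -> nat) (p : poly) :
  (forall v, eval phi nu (f v) = phi' v) ->
  (forall i, eval phi nu (g i) = nu' i) ->
  eval phi nu (subst f g p) = eval phi' nu' p.
Proof. intros Hf Hg; induction p; simpl; congruence. Qed.

Definition rename (r : nat -> nat) : poly -> poly :=
  subst (fun v => p_var (r v)) p_par.

Lemma eval_rename (r phi nu phi' : nat -> nat) (p : poly) :
  (forall v, phi (r v) = phi' v) ->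
  eval phi nu (rename r p) = eval phi' nu p.
Proof. intros Hr; apply eval_subst; [exact Hr | reflexivity]. Qed.

(** Packs two independent valuations into one, on the even and the odd indices. *)
Definition interleave (phi psi : nat -> nat) (u : nat) : nat :=
  if Nat.even u then phi (Nat.div2 u) else psi (Nat.div2 u).

Lemma interleave_even (phi psi : nat -> nat) (v : nat) :
  interleave phi psi (2 * v) = phi v.
Proof. unfold interleave; rewrite Nat.even_even, Nat.div2_double; reflexivity. Qed.

Lemma interleave_odd (phi psi : nat -> nat) (v : nat) :
  interleave phi psi (S (2 * v)) = psi v.
Proof.
unfold interleave; rewrite Nat.div2_succ_double, Nat.even_succ, Nat.odd_even.
reflexivity.
Qed.

(** * Combining two equations over the naturals *)

Lemma double_mul_lt_squares (a b : nat) : a <> b -> 2 * (a * b) < a * a + b * b.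
Proof.
intros Hab; destruct (Nat.lt_total a b) as [H|[H|H]]; [| easy |].
(* With [d] the difference of the two numbers, the claim reduces to [0 < d * d]. *)
- replace b with (a + (b - a)) by lia; nia.
- replace a with (b + (a - b)) by lia; nia.
Qed.

Lemma conj_eq_nat (a b c d : nat) :
  a * a + b * b + (c * c + d * d) = 2 * (a * b + c * d) <-> a = b /\ c = d.
Proof.
split; [intros H | intros [-> ->]; lia].
pose proof (double_mul_lt_squares a b) as Hab.
pose proof (double_mul_lt_squares c d) as Hcd.
destruct (Nat.eq_dec a b) as [<-|?], (Nat.eq_dec c d) as [<-|?]; lia.
Qed.

Lemma disj_eq_nat (a b c d : nat) :
  a * c + b * d = a * d + b * c <-> a = b \/ c = d.
Proof.
split; [intros H | intros [-> | ->]; lia].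
(* Over the integers the equation factors, and there are no zero divisors. *)
assert (Hz : ((Z.of_nat a - Z.of_nat b) * (Z.of_nat c - Z.of_nat d) = 0)%Z) by lia.
apply Z.mul_eq_0 in Hz; lia.
Qed.

(** * Formulas as single polynomial equations *)

Definition represents (A : dio_formula) (p q : poly) : Prop :=
  forall nu : nat -> nat,
    df_sem A nu <-> exists phi : nat -> nat, eval phi nu p = eval phi nu q.

Lemma represents_closed (A : dio_formula) (p q : poly) :
  (forall phi nu, df_sem A nu <-> eval phi nu p = eval phi nu q) ->
  represents A p q.
Proof.
intros H nu; split.
(* Any valuation would do here; [nu] is merely at hand. *)
- exists nu; now apply H.
- intros [phi Hphi]; now apply (H phi).
Qed.

(** The witnesses of the two conjuncts are unrelated, so the variables must first be renamed
    apart. *)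
Lemma represents_conj (A B : dio_formula) (p q p' q' : poly) :
  represents A p q -> represents B p' q' ->
  let a := rename (fun v => 2 * v) p in
  let b := rename (fun v => 2 * v) q in
  let c := rename (fun v => S (2 * v)) p' in
  let d := rename (fun v => S (2 * v)) q' in
  represents (df_conj A B)
    (p_add (p_add (p_mul a a) (p_mul b b)) (p_add (p_mul c c) (p_mul d d)))
    (p_mul (p_cst 2) (p_add (p_mul a b) (p_mul c d))).
Proof.
intros HA HB a b c d nu; cbn [df_sem eval]; rewrite (HA nu), (HB nu); split.
- intros [[phi Hphi] [psi Hpsi]]; exists (interleave phi psi).
  apply conj_eq_nat; unfold a, b, c, d; split.
  + now rewrite !(eval_rename _ _ _ _ _ (interleave_even phi psi)).
  + now rewrite !(eval_rename _ _ _ _ _ (interleave_odd phi psi)).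
- intros [phi Hphi]; apply conj_eq_nat in Hphi as [Hab Hcd].
  unfold a, b, c, d in *; split.
  + exists (fun v => phi (2 * v)).
    now rewrite <- !(eval_rename _ _ _ _ _ (fun v => eq_refl (phi (2 * v)))).
  + exists (fun v => phi (S (2 * v))).
    now rewrite <- !(eval_rename _ _ _ _ _ (fun v => eq_refl (phi (S (2 * v))))).
Qed.

(* The existential variables of the two equations may be shared here, since
   [exists] commutes with [\/]. *)
Lemma represents_disj (A B : dio_formula) (p q p' q' : poly) :
  represents A p q -> represents B p' q' ->
  represents (df_disj A B)
    (p_add (p_mul p p') (p_mul q q')) (p_add (p_mul p q') (p_mul q p')).
Proof.
intros HA HB nu; cbn [df_sem eval]; rewrite (HA nu), (HB nu); split.
- intros [[phi Hphi] | [phi Hphi]]; exists phi; apply disj_eq_nat; auto.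
- intros [phi Hphi]; apply disj_eq_nat in Hphi as [H | H]; eauto.
Qed.

(** Parameter 0, bound by the quantifier, becomes variable 0; the old variables shift up to make
    room and the other parameters shift down. *)
Definition bind_par (p : poly) : poly :=
  subst (fun v => p_var (S v))
    (fun i => match i with 0 => p_var 0 | S j => p_par j end) p.

Lemma eval_bind_par (phi nu : nat -> nat) (p : poly) :
  eval phi nu (bind_par p) = eval (fun v => phi (S v)) (scons (phi 0) nu) p.
Proof. apply eval_subst; [reflexivity | now intros [|j]]. Qed.

Lemma represents_exst (A : dio_formula) (p q : poly) :
  represents A p q -> represents (df_exst A) (bind_par p) (bind_par q).
Proof.
intros HA nu; cbn [df_sem]; split.
- intros [n Hn]; apply HA in Hn as [phi Hphi]; exists (scons n phi).
  now rewrite !eval_bind_par.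
- intros [phi Hphi]; exists (phi 0); apply HA.
  exists (fun v => phi (S v)); now rewrite <- !eval_bind_par.
Qed.

Lemma representable (A : dio_formula) : {e : poly * poly | represents A (fst e) (snd e)}.
Proof.
induction A as [i n|i j|i j k|i j k|A [[p q] HA] B [[p' q'] HB]
               |A [[p q] HA] B [[p' q'] HB]|A [[p q] HA]].
- now exists (p_par i, p_cst n); apply represents_closed.
- now exists (p_par i, p_par j); apply represents_closed.
- now exists (p_par i, p_add (p_par j) (p_par k)); apply represents_closed.
- now exists (p_par i, p_mul (p_par j) (p_par k)); apply represents_closed.
- eexists (_, _); exact (represents_conj A B p q p' q' HA HB).
- eexists (_, _); exact (represents_disj A B p q p' q' HA HB).
- eexists (_, _); exact (represents_exst A p q HA).
Qed.

(** * Flattening polynomials into elementary constraints *)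

Fixpoint size (p : poly) : nat :=
  match p with
  | p_add p q | p_mul p q => S (size p + size q)
  | _ => 1
  end.

(* In a preorder traversal of [p], the [i]-th subterm is named [node (k + i)];
   the variable [v] of [p] itself is renamed to [2 * v], so that the two kinds of
   names never clash. *)
Definition node (k : nat) : nat := S (2 * k).

Fixpoint flatten (k : nat) (p : poly) : list dio_constraint :=
  match p with
  | p_cst n => dc_cst (node k) n :: nil
  | p_var v => dc_eq (node k) (2 * v) :: nil
  | p_par i => dc_par (node k) i :: nil
  | p_add p q =>
      dc_add (node k) (node (S k)) (node (S k + size p)) ::
      flatten (S k) p ++ flatten (S k + size p) q
  | p_mul p q =>
      dc_mul (node k) (node (S k)) (node (S k + size p)) ::
      flatten (S k) p ++ flatten (S k + size p) q
  end.

(** Follows the same preorder as [flatten], so entry [i] is the value meant for [node (k + i)]. *)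
Fixpoint values (phi nu : nat -> nat) (p : poly) : list nat :=
  eval phi nu p ::
  match p with
  | p_add p q | p_mul p q => values phi nu p ++ values phi nu q
  | _ => nil
  end.

Lemma length_values (phi nu : nat -> nat) (p : poly) :
  length (values phi nu p) = size p.
Proof. induction p; simpl; rewrite ?length_app; congruence. Qed.

Lemma nth_values_0 (phi nu : nat -> nat) (p : poly) :
  nth 0 (values phi nu p) 0 = eval phi nu p.
Proof. now destruct p. Qed.

Lemma size_pos (p : poly) : 0 < size p.
Proof. destruct p; simpl; lia. Qed.

Lemma flatten_sound (phi nu : nat -> nat) (p : poly) (k : nat) :
  dc_list_sem phi nu (flatten k p) ->
  phi (node k) = eval (fun v => phi (2 * v)) nu p.
Proof.
unfold dc_list_sem; revert k.
induction p as [n|v|i|p IHp q IHq|p IHp q IHq]; intros k H;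
  cbn [flatten eval] in *; inversion_clear H as [|? ? Hc Hl]; cbn [dc_sem] in Hc;
  try exact Hc; apply Forall_app in Hl as [Hp Hq];
  now rewrite Hc, (IHp _ Hp), (IHq _ Hq).
Qed.

(** Constraining [psi] only on the block of names of [p] lets the hypothesis pass to the subterms,
    whose blocks lie inside it. *)
Lemma flatten_complete (phi psi nu : nat -> nat) (p : poly) (k : nat) :
  (forall v, psi (2 * v) = phi v) ->
  (forall i, i < size p -> psi (node (k + i)) = nth i (values phi nu p) 0) ->
  dc_list_sem psi nu (flatten k p).
Proof.
intros Hvar; unfold dc_list_sem; revert k.
assert (Hroot : forall p k,
  (forall i, i < size p -> psi (node (k + i)) = nth i (values phi nu p) 0) ->
  psi (node k) = eval phi nu p).
{ intros p' k H; rewrite <- nth_values_0, <- H by apply size_pos.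
  now rewrite Nat.add_0_r. }
induction p as [n|v|i|p IHp q IHq|p IHp q IHq]; intros k H;
  pose proof (Hroot _ _ H) as Hk; cbn [flatten];
  try (constructor; [cbn [dc_sem]; rewrite ?Hvar; exact Hk | constructor]);
  assert (Hp : forall i, i < size p ->
    psi (node (S k + i)) = nth i (values phi nu p) 0)
    by (intros i Hi; replace (S k + i) with (k + S i) by lia;
        rewrite H by (simpl; lia); simpl;
        now rewrite app_nth1 by now rewrite length_values);
  (* The block of [q] comes after the root and the whole block of [p]. *)
  assert (Hq : forall i, i < size q ->
    psi (node (S k + size p + i)) = nth i (values phi nu q) 0)
    by (intros i Hi; replace (S k + size p + i) with (k + S (size p + i)) by lia;
        rewrite H by (simpl; lia); simpl;
        rewrite app_nth2, length_values by (rewrite length_values; lia);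
        f_equal; lia);
  (constructor;
    [ cbn [dc_sem]; now rewrite (Hroot _ _ Hp), (Hroot _ _ Hq)
    | apply Forall_app; auto ]).
Qed.

(** Starting [q] at [size p] keeps its node names apart from those of [p], while the variables
    [2 * v] stay shared. *)
Definition flatten_eq (p q : poly) : list dio_constraint :=
  dc_eq (node 0) (node (size p)) :: flatten 0 p ++ flatten (size p) q.

Lemma flatten_eq_correct (p q : poly) (nu : nat -> nat) :
  (exists phi, eval phi nu p = eval phi nu q) <->
  exists psi, dc_list_sem psi nu (flatten_eq p q).
Proof.
split.
- intros [phi Hphi].
  set (vals := values phi nu p ++ values phi nu q).
  (* The default 0 is reached only at nodes that no constraint mentions. *)
  set (psi := interleave phi (fun i => nth i vals 0)).
  assert (Hnode : forall i, psi (node i) = nth i vals 0)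
    by exact (interleave_odd phi _).
  exists psi; constructor; [|apply Forall_app; split].
  + cbn [dc_sem]; rewrite !Hnode; unfold vals.
    rewrite app_nth1 by (rewrite length_values; apply size_pos).
    rewrite app_nth2, length_values by (rewrite length_values; lia).
    now rewrite Nat.sub_diag, !nth_values_0.
  + apply (flatten_complete phi); [apply interleave_even|].
    intros i Hi; rewrite Hnode; unfold vals.
    now rewrite app_nth1 by now rewrite length_values.
  + apply (flatten_complete phi); [apply interleave_even|].
    intros i Hi; rewrite Hnode; unfold vals.
    rewrite app_nth2, length_values by (rewrite length_values; lia).
    f_equal; lia.
- intros [psi Hpsi]; exists (fun v => psi (2 * v)).
  inversion_clear Hpsi as [|? ? Hc Hl]; apply Forall_app in Hl as [Hp Hq].
  now rewrite <- (flatten_sound _ _ _ _ Hp), <- (flatten_sound _ _ _ _ Hq).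
Qed.

(* "One can compute" is rendered by the informative [{l | _}], not [exists]. *)
Theorem theorem3p1 (A : dio_formula) :
  {l : list dio_constraint |
    forall nu : nat -> nat,
      df_sem A nu <-> exists phi : nat -> nat, dc_list_sem phi nu l}.
Proof.
destruct (representable A) as [[p q] HA]; exists (flatten_eq p q); intros nu.
now rewrite <- flatten_eq_correct; apply HA.
Qed.
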